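(* The logic $\mathbf{L}_{\mathrm{QN4}}$ is BP-algebraizable (algebraizable in the sense of Blok and Pigozzi with finite sets of defining equations and equivalence formulas). More precisely, with $E(\alpha):=\{\alpha\approx\alpha\to\alpha\}$ and $\Delta(\alpha,\beta):=\{\alpha\to\beta,\ \beta\to\alpha,\ \sim\alpha\to\sim\beta,\ \sim\beta\to\sim\alpha\}$, the following hold for all formulas: $\vdash\Delta(\alpha,\alpha)$; $\alpha,\Delta(\alpha,\beta)\vdash\beta$ (equivalently, $\Delta(\alpha,\beta)\vdash\Delta(\beta,\alpha)$ and $\Delta(\alpha,\beta)\cup\Delta(\beta,\gamma)\vdash\Delta(\alpha,\gamma)$); $\alpha\dashv\vdash\Delta(\alpha,\alpha\to\alpha)$; and for each connective $\bullet\in\{\sim,\land,\lor,\to\}$ of arity $n$, $\bigcup_{i=1}^n\Delta(\alpha_i,\beta_i)\vdash\Delta(\bullet(\alpha_1,\dots,\alpha_n),\bullet(\beta_1,\dots,\beta_n))$, where $\vdash$ is $\vdash_{\mathbf{L}_{\mathrm{QN4}}}$.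
   Context: Formulas are built from a denumerable set of propositional variables using the unary connective $\sim$ and the binary connectives $\land,\lor,\to$. Abbreviate $\alpha\leftrightarrow\beta:=(\alpha\to\beta)\land(\beta\to\alpha)$. The logic $\mathbf{L}_{\mathrm{QN4}}$ is the consequence relation $\vdash_{\mathbf{L}_{\mathrm{QN4}}}$ given by the Hilbert calculus whose only rule is modus ponens ($\alpha,\alpha\to\beta\vdash\beta$) and whose axiom schemes are: Ax1 $\alpha\to(\beta\to\alpha)$; Ax2 $(\alpha\to(\beta\to\gamma))\to((\alpha\to\beta)\to(\alpha\to\gamma))$; Ax3 $(\alpha\land\beta)\to\alpha$; Ax4 $(\alpha\land\beta)\to\beta$; Ax5 $(\alpha\to\beta)\to((\alpha\to\gamma)\to(\alpha\to(\beta\land\gamma)))$; Ax6 $\alpha\to(\alpha\lor\beta)$; Ax7 $\beta\to(\alpha\lor\beta)$; Ax8 $(\alpha\to\gamma)\to((\beta\to\gamma)\to((\alpha\lor\beta)\to\gamma))$; Ax9 $\sim(\alpha\lor\beta)\leftrightarrow(\sim\alpha\land\sim\beta)$; Ax10 $\sim(\alpha\to\beta)\leftrightarrow\sim\sim(\alpha\land\sim\beta)$; Ax11 $\sim(\alpha\land(\beta\land\gamma))\leftrightarrow\sim((\alpha\land\beta)\land\gamma)$; Ax12 $\sim(\alpha\land(\beta\lor\gamma))\leftrightarrow\sim((\alpha\land\beta)\lor(\alpha\land\gamma))$; Ax13 $\sim(\alpha\lor(\beta\land\gamma))\leftrightarrow\sim((\alpha\lor\beta)\land(\alpha\lor\gamma))$;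 Ax14 $\sim\sim(\alpha\land\beta)\leftrightarrow(\sim\sim\alpha\land\sim\sim\beta)$; Ax15 $\alpha\to\sim\sim\alpha$; Ax16 $\alpha\to(\sim\alpha\to\sim(\alpha\to\alpha))$; Ax17 $(\alpha\to\beta)\to(\sim\sim\alpha\to\sim\sim\beta)$; Ax18 $\sim\alpha\to\sim(\alpha\land\beta)$; Ax19 $\sim(\alpha\land\beta)\to\sim(\beta\land\alpha)$; Ax20 $(\sim\alpha\to\sim\beta)\to(\sim(\alpha\land\beta)\to\sim\beta)$; Ax21 $(\sim\alpha\to\sim\beta)\to((\sim\gamma\to\sim\theta)\to(\sim(\alpha\land\gamma)\to\sim(\beta\land\theta)))$; Ax22 $\sim\sim\sim\alpha\to\sim\alpha$. For a set $\Delta(\alpha,\beta)$ of formulas and equation set $E$, $\Delta(E(\alpha))$ denotes $\Delta(\alpha,\alpha\to\alpha)$. A logic is algebraizable (Blok–Pigozzi) iff such $E$ and $\Delta$ exist satisfying reflexivity, symmetry, transitivity, $\alpha\dashv\vdash\Delta(E(\alpha))$ and the congruence condition; BP-algebraizable means additionally both $E$ and $\Delta$ are finite. *)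

(* Defs.v *)
From mathcomp Require Import all_boot.
From mathcomp Require Import classical_sets functions cardinality.

Set Implicit Arguments.
Unset Strict Implicit.
Unset Printing Implicit Defensive.

Local Open Scope classical_set_scope.

Inductive form (V : Type) : Type :=
  | Var of V
  | Neg of form V
  | And of form V & form V
  | Or of form V & form V
  | Imp of form V & form V.

Declare Scope form_scope.
Delimit Scope form_scope with form.
Bind Scope form_scope with form.

Notation "∼ a" := (Neg a) (at level 35, right associativity) : form_scope.
Notation "a ∧ b" := (And a b) (at level 40, left associativity) : form_scope.
Notation "a ∨ b" := (Or a b) (at level 50, left associativity) : form_scope.
Notation "a ⇒ b" := (Imp a b) (at level 55, right associativity) : form_scope.
Notation "a ⇔ b" := (And (Imp a b) (Imp b a))
  (at level 60, no associativity) : form_scope.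

(* The formulas of the logic are those over countably many variables. Other   *)
(* variable types are used only for the schemes E(x) (variable type [unit])   *)
(* and Delta(x, y) (variable type [bool], x being [false] and y [true]).      *)
Definition formula := form nat.

Bind Scope form_scope with formula.

Fixpoint subst (V W : Type) (s : V -> form W) (a : form V) : form W :=
  match a with
  | Var v => s v
  | Neg a => Neg (subst s a)
  | And a b => And (subst s a) (subst s b)
  | Or a b => Or (subst s a) (subst s b)
  | Imp a b => Imp (subst s a) (subst s b)
  end.

Inductive connective := CNeg | CAnd | COr | CImp.

Definition arity (c : connective) : nat := if c is CNeg then 1 else 2.

Definition conn_app (V : Type) (c : connective) :
    ('I_(arity c) -> form V) -> form V :=
  match c with
  | CNeg => fun a => Neg (a ord0)
  | CAnd => fun a => And (a ord0) (a ord_max)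
  | COr => fun a => Or (a ord0) (a ord_max)
  | CImp => fun a => Imp (a ord0) (a ord_max)
  end.

(* A logic is a substitution-invariant (Tarskian) consequence relation.       *)
Record logic := Logic {
  entails :> set formula -> formula -> Prop;
  entails_refl : forall (G : set formula) a, G a -> entails G a;
  entails_cut : forall (G H : set formula) a,
    (forall b, H b -> entails G b) -> entails H a -> entails G a;
  entails_subst : forall (s : nat -> formula) (G : set formula) a,
    entails G a -> entails (subst s @` G) (subst s a) }.

Definition entails_set (L : logic) (G D : set formula) : Prop :=
  forall d, D d -> L G d.

Notation "G ⊢[ L ] D" := (entails_set L G D)
  (at level 70, no associativity, format "G  ⊢[ L ]  D").

Definition equation (V : Type) : Type := (form V * form V)%type.

Definition inst_eqs (E : set (equation unit)) (a : formula) :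
    set (equation nat) :=
  (fun e : equation unit =>
     (subst (fun=> a) e.1, subst (fun=> a) e.2)) @` E.

Definition inst_forms (D : set (form bool)) (a b : formula) : set formula :=
  subst (fun y : bool => if y then b else a) @` D.

Definition inst_forms_eqs (D : set (form bool)) (E : set (equation nat)) :
    set formula :=
  \bigcup_(e in E) inst_forms D e.1 e.2.

Record algebraizable_by (L : logic) (E : set (equation unit))
    (D : set (form bool)) : Prop := AlgebraizableBy {
  alg_refl : forall a : formula, set0 ⊢[L] inst_forms D a a;
  alg_sym : forall a b : formula, inst_forms D a b ⊢[L] inst_forms D b a;
  alg_trans : forall a b c : formula,
    inst_forms D a b `|` inst_forms D b c ⊢[L] inst_forms D a c;
  alg_defeq : forall a : formula,
    [set a] ⊢[L] inst_forms_eqs D (inst_eqs E a) /\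
    inst_forms_eqs D (inst_eqs E a) ⊢[L] [set a];
  alg_cong : forall (c : connective) (a b : 'I_(arity c) -> formula),
    \bigcup_i inst_forms D (a i) (b i) ⊢[L]
      inst_forms D (conn_app a) (conn_app b) }.

Definition BP_algebraizable_by (L : logic) (E : set (equation unit))
    (D : set (form bool)) : Prop :=
  [/\ finite_set E, finite_set D & algebraizable_by L E D].

Definition BP_algebraizable (L : logic) : Prop :=
  exists (E : set (equation unit)) (D : set (form bool)),
    BP_algebraizable_by L E D.

Local Open Scope form_scope.

Inductive QN4_axiom : formula -> Prop :=
  | Ax1 a b : QN4_axiom (a ⇒ (b ⇒ a))
  | Ax2 a b c : QN4_axiom ((a ⇒ (b ⇒ c)) ⇒ ((a ⇒ b) ⇒ (a ⇒ c)))
  | Ax3 a b : QN4_axiom ((a ∧ b) ⇒ a)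
  | Ax4 a b : QN4_axiom ((a ∧ b) ⇒ b)
  | Ax5 a b c : QN4_axiom ((a ⇒ b) ⇒ ((a ⇒ c) ⇒ (a ⇒ (b ∧ c))))
  | Ax6 a b : QN4_axiom (a ⇒ (a ∨ b))
  | Ax7 a b : QN4_axiom (b ⇒ (a ∨ b))
  | Ax8 a b c : QN4_axiom ((a ⇒ c) ⇒ ((b ⇒ c) ⇒ ((a ∨ b) ⇒ c)))
  | Ax9 a b : QN4_axiom (∼ (a ∨ b) ⇔ (∼ a ∧ ∼ b))
  | Ax10 a b : QN4_axiom (∼ (a ⇒ b) ⇔ ∼ ∼ (a ∧ ∼ b))
  | Ax11 a b c : QN4_axiom (∼ (a ∧ (b ∧ c)) ⇔ ∼ ((a ∧ b) ∧ c))
  | Ax12 a b c : QN4_axiom (∼ (a ∧ (b ∨ c)) ⇔ ∼ ((a ∧ b) ∨ (a ∧ c)))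
  | Ax13 a b c : QN4_axiom (∼ (a ∨ (b ∧ c)) ⇔ ∼ ((a ∨ b) ∧ (a ∨ c)))
  | Ax14 a b : QN4_axiom (∼ ∼ (a ∧ b) ⇔ (∼ ∼ a ∧ ∼ ∼ b))
  | Ax15 a : QN4_axiom (a ⇒ ∼ ∼ a)
  | Ax16 a : QN4_axiom (a ⇒ (∼ a ⇒ ∼ (a ⇒ a)))
  | Ax17 a b : QN4_axiom ((a ⇒ b) ⇒ (∼ ∼ a ⇒ ∼ ∼ b))
  | Ax18 a b : QN4_axiom (∼ a ⇒ ∼ (a ∧ b))
  | Ax19 a b : QN4_axiom (∼ (a ∧ b) ⇒ ∼ (b ∧ a))
  | Ax20 a b : QN4_axiom ((∼ a ⇒ ∼ b) ⇒ (∼ (a ∧ b) ⇒ ∼ b))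
  | Ax21 a b c d : QN4_axiom
      ((∼ a ⇒ ∼ b) ⇒ ((∼ c ⇒ ∼ d) ⇒ (∼ (a ∧ c) ⇒ ∼ (b ∧ d))))
  | Ax22 a : QN4_axiom (∼ ∼ ∼ a ⇒ ∼ a).

Inductive QN4_deriv (G : set formula) : formula -> Prop :=
  | QN4_hyp a : G a -> QN4_deriv G a
  | QN4_ax a : QN4_axiom a -> QN4_deriv G a
  | QN4_mp a b : QN4_deriv G a -> QN4_deriv G (a ⇒ b) -> QN4_deriv G b.

Lemma QN4_deriv_cut (G H : set formula) a :
  (forall b, H b -> QN4_deriv G b) -> QN4_deriv H a -> QN4_deriv G a.
Proof.
move=> GH; elim=> {a} [a /GH // | a | a b _ IHa _ IHab]; first exact: QN4_ax.
exact: QN4_mp IHa IHab.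
Qed.

Lemma QN4_axiom_subst (s : nat -> formula) a :
  QN4_axiom a -> QN4_axiom (subst s a).
Proof. by case=> *; constructor. Qed.

Lemma QN4_deriv_subst (s : nat -> formula) (G : set formula) a :
  QN4_deriv G a -> QN4_deriv (subst s @` G) (subst s a).
Proof.
elim=> {a} [a Ga | a axa | a b _ IHa _ IHab].
- by apply: QN4_hyp; exists a.
- exact/QN4_ax/QN4_axiom_subst.
- exact: QN4_mp IHa IHab.
Qed.

Definition L_QN4 : logic :=
  @Logic QN4_deriv QN4_hyp QN4_deriv_cut QN4_deriv_subst.

Definition QN4_E (V : Type) (a : form V) : set (equation V) :=
  [set (a, a ⇒ a)].

Definition QN4_Delta (V : Type) (a b : form V) : set (form V) :=
  [set a ⇒ b; b ⇒ a; ∼ a ⇒ ∼ b; ∼ b ⇒ ∼ a].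

(* Main.v *)
(* Write a <= b when both a ⇒ b and ∼ a ⇒ ∼ b are derivable, so that           *)
(* Delta(a, b) says a <= b and b <= a. Positively the connectives are those   *)
(* of intuitionistic logic; the negations of compounds are controlled by Ax9  *)
(* for ∨, Ax17 for ∼, Ax21 for ∧, and Ax10 with Ax17 for ⇒. The only other    *)
(* delicate point is ∼ (a ⇒ a) ⇒ ∼ a, which follows from Ax10, Ax14 and Ax22. *)
Require Import Defs.
From mathcomp Require Import all_boot.
From mathcomp Require Import classical_sets functions cardinality.

Set Implicit Arguments.
Unset Strict Implicit.
Unset Printing Implicit Defensive.

Local Open Scope classical_set_scope.
Local Open Scope form_scope.

(** For every set [G] of hypotheses, derivability from [G] makes [deriv_le] a preorder, and
    [QN4_Delta] is its induced equivalence, so reflexivity, symmetry and transitivity come from the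
    preorder laws. Congruence reduces to monotonicity: [deriv_le_neg], [deriv_le_and] and
    [deriv_le_or] are covariant, while [deriv_le_imp] needs both directions on its antecedents. For
    the defining equation, [a ⇒ a] is a theorem, so [a] is derivable once it is equivalent to it;
    conversely [a] yields the equivalence by Ax1, Ax16 and [deriv_neg_self_imp]. *)

Section Derivations.
Variable G : set formula.
Implicit Types a b c d : formula.

Local Notation "⊢ a" := (QN4_deriv G a) (at level 70).

Lemma deriv_weak a b : ⊢ b -> ⊢ (a ⇒ b).
Proof. by move=> /QN4_mp; apply; apply/QN4_ax/Ax1. Qed.

(** Modus ponens under a common antecedent. With [deriv_weak] it replaces a deduction theorem. *)
Lemma deriv_mp_imp a b c : ⊢ (a ⇒ b) -> ⊢ (a ⇒ b ⇒ c) -> ⊢ (a ⇒ c).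
Proof.
by move=> ab abc; apply: (QN4_mp ab); apply: (QN4_mp abc); apply/QN4_ax/Ax2.
Qed.

Lemma deriv_trans b a c : ⊢ (a ⇒ b) -> ⊢ (b ⇒ c) -> ⊢ (a ⇒ c).
Proof. by move=> ab /(deriv_weak a); apply: deriv_mp_imp. Qed.

Lemma deriv_refl a : ⊢ (a ⇒ a).
Proof. by apply: (@deriv_mp_imp a (a ⇒ a)); apply/QN4_ax/Ax1. Qed.

Lemma deriv_andl a b : ⊢ (a ∧ b ⇒ a).
Proof. exact/QN4_ax/Ax3. Qed.

Lemma deriv_andr a b : ⊢ (a ∧ b ⇒ b).
Proof. exact/QN4_ax/Ax4. Qed.

Lemma deriv_and a b c : ⊢ (a ⇒ b) -> ⊢ (a ⇒ c) -> ⊢ (a ⇒ b ∧ c).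
Proof.
by move=> ab ac; apply: (QN4_mp ac); apply: (QN4_mp ab); apply/QN4_ax/Ax5.
Qed.

Lemma deriv_and_mono a b c d :
  ⊢ (a ⇒ b) -> ⊢ (c ⇒ d) -> ⊢ (a ∧ c ⇒ b ∧ d).
Proof.
by move=> ab cd; apply: deriv_and;
  [apply: deriv_trans (deriv_andl a c) ab
  |apply: deriv_trans (deriv_andr a c) cd].
Qed.

Lemma deriv_or_mono a b c d :
  ⊢ (a ⇒ b) -> ⊢ (c ⇒ d) -> ⊢ (a ∨ c ⇒ b ∨ d).
Proof.
move=> ab cd.
have abd : ⊢ (a ⇒ b ∨ d) by apply: (deriv_trans ab); apply/QN4_ax/Ax6.
have cbd : ⊢ (c ⇒ b ∨ d) by apply: (deriv_trans cd); apply/QN4_ax/Ax7.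
by apply: (QN4_mp cbd); apply: (QN4_mp abd); apply/QN4_ax/Ax8.
Qed.

Lemma deriv_imp_mono a b c d :
  ⊢ (b ⇒ a) -> ⊢ (c ⇒ d) -> ⊢ ((a ⇒ c) ⇒ (b ⇒ d)).
Proof.
move=> ba cd; apply: (@deriv_trans (b ⇒ c)).
  (* Antecedent first: Ax1 turns [a ⇒ c] into [b ⇒ a ⇒ c], which Ax2 distributes and [b ⇒ a] then
     discharges. *)
  apply: (deriv_mp_imp (deriv_weak _ ba)).
  by apply: (@deriv_trans (b ⇒ a ⇒ c)); apply/QN4_ax; [apply: Ax1|apply: Ax2].
by apply: (QN4_mp (deriv_weak b cd)); apply/QN4_ax/Ax2.
Qed.

Lemma deriv_negneg_mono a b : ⊢ (a ⇒ b) -> ⊢ (∼ ∼ a ⇒ ∼ ∼ b).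
Proof. by move=> /QN4_mp; apply; apply/QN4_ax/Ax17. Qed.

Lemma axiom_iffl a b : QN4_axiom (a ⇔ b) -> ⊢ (a ⇒ b).
Proof. by move=> /(QN4_ax G)/QN4_mp; apply; apply: deriv_andl. Qed.

Lemma axiom_iffr a b : QN4_axiom (a ⇔ b) -> ⊢ (b ⇒ a).
Proof. by move=> /(QN4_ax G)/QN4_mp; apply; apply: deriv_andr. Qed.

(** The chain runs from [∼ (a ⇒ a)] through [∼ ∼ (a ∧ ∼ a)] and [∼ ∼ a ∧ ∼ ∼ ∼ a] to [∼ ∼ ∼ a],
    hence to [∼ a]. *)
Lemma deriv_neg_self_imp a : ⊢ (∼ (a ⇒ a) ⇒ ∼ a).
Proof.
apply: deriv_trans (axiom_iffl (Ax10 a a)) _.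
apply: deriv_trans (axiom_iffl (Ax14 a (∼ a))) _.
by apply: deriv_trans (deriv_andr _ _) _; apply/QN4_ax/Ax22.
Qed.

Definition deriv_le a b := ⊢ (a ⇒ b) /\ ⊢ (∼ a ⇒ ∼ b).

Lemma deriv_DeltaP a b :
  G ⊢[L_QN4] QN4_Delta a b <-> deriv_le a b /\ deriv_le b a.
Proof.
split=> [Dab | [[ab nab] [ba nba]] _ [[[->|->]|->]|->] //].
by split; split; apply: Dab; rewrite /QN4_Delta /=; tauto.
Qed.

(** The negative half of the hypothesis becomes the positive half of the conclusion; only the doubly
    negated half needs an argument. *)
Lemma deriv_le_neg a b : deriv_le a b -> deriv_le (∼ a) (∼ b).
Proof. by move=> [ab nab]; split=> //; apply: deriv_negneg_mono. Qed.

Lemma deriv_le_and a b c d :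
  deriv_le a b -> deriv_le c d -> deriv_le (a ∧ c) (b ∧ d).
Proof.
move=> [ab nab] [cd ncd]; split; first exact: deriv_and_mono.
by apply: (QN4_mp ncd); apply: (QN4_mp nab); apply/QN4_ax/Ax21.
Qed.

Lemma deriv_le_or a b c d :
  deriv_le a b -> deriv_le c d -> deriv_le (a ∨ c) (b ∨ d).
Proof.
move=> [ab nab] [cd ncd]; split; first exact: deriv_or_mono.
apply: deriv_trans (axiom_iffl (Ax9 a c)) _.
by apply: deriv_trans (axiom_iffr (Ax9 b d)); apply: deriv_and_mono.
Qed.

(** The antecedent is contravariant in [a ⇒ c] but covariant in [∼ (a ⇒ c)], which amounts to
    [∼ ∼ (a ∧ ∼ c)]; hence the comparison of [a] and [b] both ways. *)
Lemma deriv_le_imp a b c d :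
  deriv_le a b -> deriv_le b a -> deriv_le c d -> deriv_le (a ⇒ c) (b ⇒ d).
Proof.
move=> [ab _] [ba _] [cd ncd]; split; first exact: deriv_imp_mono.
apply: deriv_trans (axiom_iffl (Ax10 a c)) _.
apply: deriv_trans (axiom_iffr (Ax10 b d)).
by apply: deriv_negneg_mono; apply: deriv_and_mono.
Qed.

End Derivations.

Lemma deriv_Delta_refl (a : formula) : set0 ⊢[L_QN4] QN4_Delta a a.
Proof. by apply/deriv_DeltaP; split; split; apply: deriv_refl. Qed.

Lemma deriv_Delta_mp (a b : formula) :
  [set a] `|` QN4_Delta a b ⊢[L_QN4] [set b].
Proof.
move=> _ ->; apply: (@QN4_mp _ a); apply: QN4_hyp; first by left.
by right; rewrite /QN4_Delta /=; tauto.
Qed.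

Lemma deriv_Delta_sym (a b : formula) :
  QN4_Delta a b ⊢[L_QN4] QN4_Delta b a.
Proof.
have /deriv_DeltaP[ab ba] : QN4_Delta a b ⊢[L_QN4] QN4_Delta a b.
  exact: QN4_hyp.
exact/deriv_DeltaP.
Qed.

Lemma deriv_Delta_trans (a b c : formula) :
  QN4_Delta a b `|` QN4_Delta b c ⊢[L_QN4] QN4_Delta a c.
Proof.
set G := _ `|` _.
have /deriv_DeltaP[[ab nab] [ba nba]] : G ⊢[L_QN4] QN4_Delta a b.
  by move=> d Dd; apply: QN4_hyp; left.
have /deriv_DeltaP[[bc nbc] [cb ncb]] : G ⊢[L_QN4] QN4_Delta b c.
  by move=> d Dd; apply: QN4_hyp; right.
apply/deriv_DeltaP; split; split.
- exact: deriv_trans ab bc.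
- exact: deriv_trans nab nbc.
- exact: deriv_trans cb ba.
- exact: deriv_trans ncb nba.
Qed.

Lemma deriv_Delta_defeq (a : formula) :
  [set a] ⊢[L_QN4] QN4_Delta a (a ⇒ a) /\
  QN4_Delta a (a ⇒ a) ⊢[L_QN4] [set a].
Proof.
split=> [|_ ->]; last first.
  apply: QN4_mp (deriv_refl _ a) _; apply: QN4_hyp.
  by rewrite /QN4_Delta /=; tauto.
have ha : QN4_deriv [set a] a by apply: QN4_hyp.
apply/deriv_DeltaP; split; split.
- exact/deriv_weak/deriv_refl.
(* Detaching [a] from Ax16 leaves exactly [∼ a ⇒ ∼ (a ⇒ a)]. *)
- by apply: (QN4_mp ha); apply/QN4_ax/Ax16.
- exact: deriv_weak.
- exact: deriv_neg_self_imp.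
Qed.

Lemma deriv_Delta_cong (c : connective) (a b : 'I_(arity c) -> formula) :
  \bigcup_i QN4_Delta (a i) (b i) ⊢[L_QN4]
    QN4_Delta (conn_app a) (conn_app b).
Proof.
set G := \bigcup_i _.
have Gle i : deriv_le G (a i) (b i) /\ deriv_le G (b i) (a i).
  by apply/deriv_DeltaP => d Dd; apply: QN4_hyp; exists i.
(* Forgetting that [G] is built from the families lets the case analysis on [c] change their index
   type. *)
apply/deriv_DeltaP; move: G Gle => G.
case: c a b => /= a b Gle; have [ab0 ba0] := Gle ord0.
- by split; apply: deriv_le_neg.
- by have [ab1 ba1] := Gle ord_max; split; apply: deriv_le_and.
- by have [ab1 ba1] := Gle ord_max; split; apply: deriv_le_or.
- by have [ab1 ba1] := Gle ord_max; split; apply: deriv_le_imp.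
Qed.

Lemma inst_forms_Delta (a b : formula) :
  inst_forms (QN4_Delta (Var false) (Var true)) a b = QN4_Delta a b.
Proof. by rewrite /inst_forms /QN4_Delta !image_setU !image_set1. Qed.

Lemma inst_forms_eqs_Delta (a : formula) :
  inst_forms_eqs (QN4_Delta (Var false) (Var true))
    (inst_eqs (QN4_E (Var tt)) a) = QN4_Delta a (a ⇒ a).
Proof.
by rewrite /inst_forms_eqs /inst_eqs /QN4_E image_set1 bigcup_set1
  inst_forms_Delta.
Qed.

Lemma QN4_BP_algebraizable_by :
  BP_algebraizable_by L_QN4 (QN4_E (Var tt)) (QN4_Delta (Var false) (Var true)).
Proof.
split; first exact: finite_set1.
  by rewrite /QN4_Delta !finite_setU; do !split; apply: finite_set1.
split=> [a|a b|a b c|a|c a b].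
- by rewrite inst_forms_Delta; apply: deriv_Delta_refl.
- by rewrite !inst_forms_Delta; apply: deriv_Delta_sym.
- by rewrite !inst_forms_Delta; apply: deriv_Delta_trans.
- by rewrite inst_forms_eqs_Delta; apply: deriv_Delta_defeq.
- rewrite inst_forms_Delta.
  under eq_bigcupr do rewrite inst_forms_Delta.
  exact: deriv_Delta_cong.
Qed.

Theorem theorem4 :
  BP_algebraizable L_QN4 /\
  BP_algebraizable_by L_QN4
    (QN4_E (Var tt)) (QN4_Delta (Var false) (Var true)) /\
  (forall a : formula, set0 ⊢[L_QN4] QN4_Delta a a) /\
  (forall a b : formula, [set a] `|` QN4_Delta a b ⊢[L_QN4] [set b]) /\
  (forall a b : formula, QN4_Delta a b ⊢[L_QN4] QN4_Delta b a) /\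
  (forall a b c : formula,
     QN4_Delta a b `|` QN4_Delta b c ⊢[L_QN4] QN4_Delta a c) /\
  (forall a : formula,
     [set a] ⊢[L_QN4] QN4_Delta a (a ⇒ a) /\
     QN4_Delta a (a ⇒ a) ⊢[L_QN4] [set a]) /\
  (forall (c : connective) (a b : 'I_(arity c) -> formula),
     \bigcup_i QN4_Delta (a i) (b i) ⊢[L_QN4]
       QN4_Delta (conn_app a) (conn_app b)).
Proof.
split; first by do 2 eexists; apply: QN4_BP_algebraizable_by.
split; first exact: QN4_BP_algebraizable_by.
split; first exact: deriv_Delta_refl.
split; first exact: deriv_Delta_mp.
split; first exact: deriv_Delta_sym.
split; first exact: deriv_Delta_trans.
by split; [apply: deriv_Delta_defeq | apply: deriv_Delta_cong].
Qed.
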